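(* Let $r\ge 1$ be an integer. In every spanning partition of a finite biclique into $r$ bi-equivalence graphs $G_1,\dots,G_r$, each $G_i$ has width at most $2^{r-1}$. This is best possible: for every $r\ge 1$ there is a spanning partition of some biclique into $r$ bi-equivalence graphs in which some $G_i$ has width exactly $2^{r-1}$.
   Context: A biclique $[X,Y]$ is a complete bipartite graph with nonempty vertex classes $X$ and $Y$. A bi-equivalence graph is a graph each of whose connected components is a biclique. A partition of a biclique $G$ into bi-equivalence graphs $G_1,\dots,G_r$ means that every edge of $G$ belongs to exactly one $G_i$, each $G_i$ being a bi-equivalence graph. The partition is spanning if every vertex of $G$ is incident with at least one edge of each $G_i$. The width of $G_i$ is the number of its connected components. *)

(* Defs.v *)
From mathcomp Require Import all_boot.

Set Implicit Arguments.
Unset Strict Implicit.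
Unset Printing Implicit Defensive.

(* Finite simple graphs whose vertices are drawn from an ambient finite type T;
   the vertex set may be a proper subset of T, so that a graph and its subgraphs
   have the same type. *)
Record graph (T : finType) := Graph {
  vertices : {set T};
  adj : rel T;
  adj_sym : symmetric adj;
  adj_irr : irreflexive adj;
  adj_vertices : forall x y : T, adj x y -> x \in vertices
}.

Section Graphs.
Variable T : finType.
Implicit Types (G H : graph T) (X Y C : {set T}).

Definition subgraph H G : Prop :=
  vertices H \subset vertices G /\ (forall x y : T, adj H x y -> adj G x y).

Section Induced.
Variables (G : graph T) (C : {set T}).

Definition induced_adj : rel T :=
  fun x y => [&& x \in C, y \in C & adj G x y].

Lemma induced_adj_sym : symmetric induced_adj.
Proof. by move=> x y; rewrite /induced_adj adj_sym andbCA. Qed.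

Lemma induced_adj_irr : irreflexive induced_adj.
Proof. by move=> x; rewrite /induced_adj adj_irr !andbF. Qed.

Lemma induced_adj_vertices x y :
  induced_adj x y -> x \in vertices G :&: C.
Proof. by case/and3P=> xC _ /adj_vertices xG; rewrite inE xG. Qed.

Definition induced : graph T :=
  Graph induced_adj_sym induced_adj_irr induced_adj_vertices.
End Induced.

Definition biclique_on X Y G : Prop :=
  [/\ X != set0, Y != set0, [disjoint X & Y], vertices G = X :|: Y
    & forall x y : T,
        adj G x y = (x \in X) && (y \in Y) || (x \in Y) && (y \in X)].

Definition biclique G : Prop := exists X Y : {set T}, biclique_on X Y G.

(* The vertex sets of the connected components; an isolated vertex of G would
   form a component by itself. *)
Definition components G : {set {set T}} :=
  equivalence_partition (connect (adj G)) (vertices G).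

Definition width G : nat := #|components G|.

Definition bi_equivalence G : Prop :=
  forall C, C \in components G -> biclique (induced G C).

Definition bi_equivalence_partition (r : nat) G (Gs : 'I_r -> graph T) : Prop :=
  [/\ forall i : 'I_r, bi_equivalence (Gs i),
      forall i : 'I_r, subgraph (Gs i) G
    & forall x y : T, adj G x y -> exists! i : 'I_r, adj (Gs i) x y].

Definition spanning (r : nat) G (Gs : 'I_r -> graph T) : Prop :=
  forall (i : 'I_r) (x : T), x \in vertices G -> exists y : T, adj (Gs i) x y.
End Graphs.

(* Main.v *)
(* Upper bound: fix i and choose an edge x_c y_c of G_i, with x_c in X and y_c
   in Y, in each component c of G_i.  Label vertices by numbers so that two
   vertices get the same label at j iff they lie in the same component of G_j.
   For c <> c' the labels of x_c and y_c' agree at some j <> i, whereas those of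
   x_c and y_c agree at no j <> i.  Hence the matrix with (c, c') entry
   \prod_(j != i) (label_j x_c - label_j y_c') is diagonal with nonzero diagonal
   entries.  Expanding the product factors it through dimension 2 ^ (r - 1), so
   its rank, the width of G_i, is at most 2 ^ (r - 1).
   Sharpness: take two copies of the binary words of length r - 1, and put the
   edge xy into G_j, where j = 0 if x = y, and otherwise j is one plus the last
   position in which x and y differ; then G_0 is a perfect matching. *)
Require Import Defs.
From mathcomp Require Import all_boot all_algebra.

Set Implicit Arguments.
Unset Strict Implicit.
Unset Printing Implicit Defensive.

(** * Rank bound from a diagonal product matrix *)

Section DiagonalProduct.
Import GRing.Theory.
Local Open Scope ring_scope.

Lemma card_le_exp2_of_agreement (F : fieldType) (I J : finType)
    (a b : I -> J -> F) :
    (forall c j, a c j != b c j) ->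
    (forall c c', c != c' -> exists j, a c j = b c' j) ->
  (#|I| <= 2 ^ #|J|)%N.
Proof.
move=> ab_neq ab_agree.
(* Expanding a product of differences over [J] gives one term per subset [S]: [a] is chosen on [S]
   and [- b] off [S]. [P] and [Q] are the parts of this term that depend on the row and on the
   column. *)
pose P (c : 'I_#|I|) (S : 'I_#|{set J}|) :=
  \prod_(j in enum_val S) a (enum_val c) j.
pose Q (S : 'I_#|{set J}|) (c : 'I_#|I|) :=
  \prod_(j | j \notin enum_val S) (- b (enum_val c) j).
pose A := \matrix_(c, S) P c S; pose B := \matrix_(S, c) Q S c.
pose d (c : 'I_#|I|) := \prod_j (a (enum_val c) j - b (enum_val c) j).
have AB : A *m B = diag_mx (\row_c d c).
  apply/matrixP=> c c'; rewrite !mxE.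
  transitivity (\prod_j (a (enum_val c) j - b (enum_val c') j)).
    rewrite bigA_distr (reindex (@enum_val {set J} predT)) /=; last first.
      by apply: onW_bij; apply: enum_val_bij.
    rewrite big_mkcond /=; apply: eq_big => [S|S _]; first by rewrite inE.
    rewrite !mxE (bigID (mem (enum_val S))) /=; congr (_ * _).
      by apply: eq_bigr => j ->.
    by apply: eq_bigr => j /negbTE ->.
  have [->|nc] := eqVneq c c'; first by rewrite mulr1n.
  have /ab_agree[j abj] : enum_val c != enum_val c'.
    by rewrite (inj_eq enum_val_inj).
  by rewrite mulr0n (bigD1 j) //= abj subrr mul0r.
have AB_unit : A *m B \in unitmx.
  rewrite AB unitmxE det_diag unitfE; apply/prodf_neq0 => c _.
  by rewrite mxE; apply/prodf_neq0 => j _; rewrite subr_eq0.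
(* The invertible product has rank [#|I|], at most the number of columns of [A], which are indexed
   by the subsets of [J]. *)
rewrite -(mxrank_unit AB_unit) (leq_trans (mxrankM_maxl _ _)) //.
apply: leq_trans (rank_leq_col _) _.
by rewrite -[#|{set J}|]cardsT -powersetT card_powerset cardsT.
Qed.

End DiagonalProduct.

(** * Components of bi-equivalence subgraphs and the upper bound *)

Section Components.
Variable T : finType.
Implicit Types (G H : graph T) (X Y C : {set T}).

Lemma connect_adj_sym G : connect_sym (adj G).
Proof. exact/sym_connect_sym/adj_sym. Qed.

Lemma connect_vertices G x y :
  connect (adj G) x y -> x != y -> x \in vertices G.
Proof.
case/connectP=> -[|z p] /= => [_ ->|]; first by rewrite eqxx.
by case/andP=> /adj_vertices.
Qed.

Lemma components_partition G : partition (components G) (vertices G).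
Proof.
apply: equivalence_partitionP => x y z _ _ _.
split; first exact: connect0.
by move=> cxy; apply: same_connect => //; apply: connect_adj_sym.
Qed.

Lemma component_connect G C x y :
  C \in components G -> x \in C -> connect (adj G) x y -> y \in C.
Proof.
case/imsetP=> z zG ->; rewrite !inE => /andP[xG czx] cxy.
rewrite (connect_trans czx cxy) andbT.
have [->//|nxy] := eqVneq y x.
by apply: connect_vertices nxy; rewrite connect_adj_sym.
Qed.

Lemma mem_component G x : x \in vertices G ->
  exists2 C, C \in components G & x \in C.
Proof.
move=> xG; exists [set y in vertices G | connect (adj G) x y].
  exact: imset_f.
by rewrite inE xG connect0.
Qed.

Lemma subgraph_bicliqueE X Y G H x y :
    biclique_on X Y G -> subgraph H G -> adj H x y ->
  (x \in X) && (y \in Y) || (x \in Y) && (y \in X).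
Proof. by case=> _ _ _ _ GE [_ HG] /HG; rewrite GE. Qed.

(** If [x] and [y] were in the same class of their component in [H], they would have a common
    neighbour, which would lie in both [X] and [Y]. So they are in opposite classes and hence
    adjacent. *)
Lemma connect_bi_equivalence X Y G H x y :
    biclique_on X Y G -> subgraph H G -> bi_equivalence H ->
    x \in X -> y \in Y ->
  connect (adj H) x y = adj H x y.
Proof.
move=> bG sHG eH xX yY; apply/idP/idP; last exact: connect1.
move=> cxy; have [_ _ dXY _ _] := bG.
have dis z : z \in X -> z \in Y -> False.
  by move=> zX zY; rewrite (disjointFr dXY zX) in zY.
have nxy : x != y by apply/eqP=> e; apply: (dis x) => //; rewrite e.
have xH := connect_vertices cxy nxy.
have [C CH xC] := mem_component xH.
have yC := component_connect CH xC cxy.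
have [X' [Y' [X'0 Y'0 _ VE AE]]] := eH C CH.
have adjE u v : (u \in X') && (v \in Y') || (u \in Y') && (v \in X') -> adj H u v.
  by rewrite -AE => /and3P[].
have nb z : adj H x z -> adj H y z -> False.
  move=> /(subgraph_bicliqueE bG sHG) xz /(subgraph_bicliqueE bG sHG) yz.
  case/orP: xz => /andP[xz zz]; last exact: (dis x).
  by case/orP: yz => /andP[yz zz']; [apply: (dis y)|apply: (dis z)].
have : x \in X' :|: Y' by rewrite -VE inE xH.
have : y \in X' :|: Y'.
  rewrite -VE inE yC andbT.
  by case/imsetP: CH yC => z _ ->; rewrite inE => /andP[].
rewrite !inE => /orP[]yX /orP[]xX'.
- case/set0Pn: Y'0 => z zY'; case: (nb z); apply: adjE.
    by rewrite xX' zY'.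
  by rewrite yX zY'.
- by apply: adjE; rewrite yX xX' orbT.
- by apply: adjE; rewrite yX xX'.
- case/set0Pn: X'0 => z zX'; case: (nb z); apply: adjE.
    by rewrite xX' zX' orbT.
  by rewrite yX zX' orbT.
Qed.

Lemma component_edge X Y G H C :
    biclique_on X Y G -> subgraph H G -> bi_equivalence H ->
    C \in components H ->
  exists p : T * T,
    [/\ p.1 \in X, p.2 \in Y, p.1 \in C, p.2 \in C & adj H p.1 p.2].
Proof.
move=> bG sHG eH CH.
have [X' [Y' [/set0Pn[x xX'] /set0Pn[y yY'] _ _ AE]]] := eH C CH.
have : adj (induced H C) x y by rewrite AE xX' yY'.
case/and3P=> xC yC xy.
case/orP: (subgraph_bicliqueE bG sHG xy) => /andP[xX yX].
  by exists (x, y).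
by exists (y, x); split; rewrite // adj_sym.
Qed.

Theorem width_bi_equivalence_partition n G (Gs : 'I_n.+1 -> graph T) i :
  biclique G -> bi_equivalence_partition G Gs -> width (Gs i) <= 2 ^ n.
Proof.
case=> X [Y bG] [eGs sGs pGs].
have /fin_all_exists[p pP] (c : {C | C \in components (Gs i)}) :=
  component_edge bG (sGs i) (eGs i) (valP c).
(* A component is encoded by the rank of its canonical root, cast to [rat] because the matrix
   argument needs a field. *)
pose label j x : rat := ((enum_rank (fingraph.root (adj (Gs j)) x) : nat)%:R)%R.
have labelE j c c' : (label j (p c).1 == label j (p c').2)
                     = adj (Gs j) (p c).1 (p c').2.
  have [xX _ _ _ _] := pP c; have [_ yY _ _ _] := pP c'.
  rewrite -(connect_bi_equivalence bG (sGs j) (eGs j) xX yY).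
  rewrite -(root_connect (connect_adj_sym (Gs j))).
  rewrite Num.Theory.eqr_nat.
  by rewrite (inj_eq val_inj) (inj_eq enum_rank_inj).
have adjG c c' : adj G (p c).1 (p c').2.
  have [xX _ _ _ _] := pP c; have [_ yY _ _ _] := pP c'.
  by case: bG => _ _ _ _ ->; rewrite xX yY.
rewrite /width -card_sig -[n in 2 ^ n]card_ord.
(* [lift i] enumerates the [n] indices other than [i]. *)
apply: (@card_le_exp2_of_agreement _ _ _
  (fun c j => label (lift i j) (p c).1) (fun c j => label (lift i j) (p c).2)).
  move=> c j; rewrite labelE; apply: contraNN (neq_lift i j) => adj_j.
  have [k [_ k_uniq]] := pGs _ _ (adjG c c).
  have [_ _ _ _ adj_i] := pP c.
  by rewrite -(k_uniq _ adj_j) -(k_uniq _ adj_i).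
move=> c c' ncc'; have [k [adj_k _]] := pGs _ _ (adjG c c').
(* Were the edge between [c] and [c'] in [Gs i], it would merge these two distinct components. *)
have [j kE|kE] := unliftP i k; last first.
  rewrite kE in adj_k; case/eqP: ncc'; apply/val_inj.
  have [_ _ xC _ _] := pP c; have [_ _ _ yC' _] := pP c'.
  have yC := component_connect (valP c) xC (connect1 adj_k).
  have /and3P[_ tI _] := components_partition (Gs i).
  by rewrite -(def_pblock tI (valP c) yC) (def_pblock tI (valP c') yC').
by exists j; apply/eqP; rewrite labelE -kE.
Qed.

End Components.

(** * Bipartite graphs defined by vertex labels *)

Section LabelledGraph.
Variables (T : finType) (L : finType) (side : T -> bool) (f : T -> L).

Definition label_adj : rel T := fun x y => (side x != side y) && (f x == f y).

Lemma label_adj_sym : symmetric label_adj.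
Proof. by move=> x y; rewrite /label_adj eq_sym (eq_sym (f x)). Qed.

Lemma label_adj_irr : irreflexive label_adj.
Proof. by move=> x; rewrite /label_adj eqxx. Qed.

Lemma label_adj_vertices x y : label_adj x y -> x \in [set: T].
Proof. by rewrite inE. Qed.

Definition label_graph : graph T :=
  Graph label_adj_sym label_adj_irr label_adj_vertices.

Hypothesis label_nbr : forall x, exists y, label_adj x y.

(** Edges preserve labels. Conversely, equally labelled vertices on one side are joined by a path of
    length two through a neighbour given by [label_nbr]. *)
Lemma connect_label_adj x y : connect label_adj x y = (f x == f y).
Proof.
apply/idP/eqP=> [/connectP[p]|fxy].
  elim: p x => [|z p IHp] x /= => [_ -> //|].
  by case/andP=> /andP[_ /eqP ->]; apply: IHp.
have [sxy|nsxy] := eqVneq (side x) (side y); last first.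
  by apply: connect1; rewrite /label_adj nsxy fxy eqxx.
have [z xz] := label_nbr x; apply: (connect_trans (connect1 xz)).
apply: connect1; rewrite label_adj_sym.
by move: xz; rewrite /label_adj sxy fxy.
Qed.

Lemma label_componentsE :
  components label_graph = [set [set y | f x == f y] | x in [set: T]].
Proof.
by apply: eq_imset => x; apply/setP=> y; rewrite !inE connect_label_adj.
Qed.

Lemma label_graph_bi_equivalence : bi_equivalence label_graph.
Proof.
move=> C; rewrite label_componentsE => /imsetP[x _ ->].
have [y /andP[nsxy /eqP fxy]] := label_nbr x.
exists [set z | (f x == f z) && ~~ side z], [set z | (f x == f z) && side z].
split.
- apply/set0Pn; case: (boolP (side x)) => sx; [exists y|exists x].
    by rewrite inE fxy eqxx; move: nsxy; rewrite sx; case: (side y).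
  by rewrite inE eqxx.
- apply/set0Pn; case: (boolP (side x)) => sx; [exists x|exists y].
    by rewrite inE eqxx.
  by rewrite inE fxy eqxx; move: nsxy; rewrite (negbTE sx); case: (side y).
- by apply/pred0P=> z /=; rewrite !inE; case: (side z); rewrite !andbF.
- by apply/setP=> z; rewrite !inE /= -andb_orr orNb andbT.
move=> u v; rewrite /= /induced_adj /= /label_adj !inE.
have [<-|_] //= := eqVneq (f x) (f u); first last.
by have [_|_] := eqVneq (f x) (f v); case: (side u); case: (side v).
Qed.

Lemma width_label_graph : width label_graph = #|f @: [set: T]|.
Proof.
rewrite /width label_componentsE (imset_comp (fun l => [set y | l == f y]) f).
apply: card_in_imset => _ _ /imsetP[x _ ->] /imsetP[y _ ->] /setP/(_ x).
by rewrite !inE eqxx => /esym/eqP.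
Qed.

End LabelledGraph.

(** * The sharp example on binary words *)

Section BinaryWords.
Variable n : nat.
Let W := {ffun 'I_n -> bool}.

(* Zeroing the positions i with i.+1 < j and, on one side only, flipping the
   position i with i.+1 = j, makes words x and y on opposite sides get the same
   label iff x and y coincide from position j on and differ just before it. *)
Definition word_label (j : 'I_n.+1) (v : bool * W) : W :=
  [ffun i : 'I_n => (j <= i.+1) && (v.2 i (+) (v.1 && (j == i.+1 :> nat)))].

Definition word_graph j := label_graph fst (word_label j).

Lemma word_label_nbr j v : exists w, label_adj fst (word_label j) v w.
Proof.
(* Changing side toggles the flip just before position [j]; flipping that letter compensates. *)
exists (~~ v.1, [ffun i => v.2 i (+) (j == i.+1 :> nat)]).
rewrite /label_adj /=; apply/andP; split; first by case: v.1.
apply/eqP/ffunP=> i; rewrite !ffunE /=.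
by case: (v.1); case: (v.2 i); case: (j == _ :> nat).
Qed.

Lemma word_labelP (j : 'I_n.+1) (x y : W) s :
  reflect (forall i : 'I_n, j <= i.+1 -> x i = y i (+) (j == i.+1 :> nat))
          (word_label j (s, x) == word_label j (~~ s, y)).
Proof.
apply: (iffP eqP) => [/ffunP xy i ji|xy].
  move: (xy i); rewrite !ffunE /= ji /=.
  by case: s (x i) (y i) (j == _ :> nat) {xy} => [] [] [] [].
apply/ffunP=> i; rewrite !ffunE /=; case: leqP => //= /xy ->.
by case: s (y i) (j == _ :> nat) => [] [] [].
Qed.

Lemma word_label_agree_uniq (x y : W) s :
  exists! j, word_label j (s, x) == word_label j (~~ s, y).
Proof.
(* The required index is the least [j] from which the words agree; by minimality they differ just
   before it if [j] is positive. *)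
pose eq_from j := [forall i : 'I_n, (j <= i) ==> (x i == y i)].
have exj : exists j, eq_from j.
  by exists n; apply/forallP=> i; rewrite leqNgt ltn_ord.
case: (ex_minnP exj) => j /forallP jP jmin.
have jn : j < n.+1.
  by apply: jmin; apply/forallP=> i; rewrite leqNgt ltn_ord.
exists (Ordinal jn); split.
  apply/word_labelP=> i /=; rewrite leq_eqVlt => /orP[/eqP ji|ji]; last first.
    by rewrite (ltn_eqF ji) addbF; move: (jP i); rewrite -ltnS ji => /eqP.
  rewrite ji eqxx addbT; apply/eqP; apply/negbNE/negP => nxy.
  suff /jmin : eq_from i by rewrite ji ltnn.
  apply/forallP=> k; apply/implyP; rewrite leq_eqVlt => /orP[/eqP/val_inj <-|ik].
    by move: nxy; case: (x i) (y i) => [] [].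
  by move: (jP k); rewrite ji ik.
move=> k /word_labelP kP; apply/val_inj/eqP => /=; rewrite eqn_leq.
apply/andP; split.
  apply: jmin; apply/forallP=> i; apply/implyP=> ki.
  by rewrite (kP i (leqW ki)) (ltn_eqF (_ : k < i.+1)) ?addbF.
(* If [j < k], the words would have to differ at [k.-1], where they agree by the choice of [j]. *)
rewrite leqNgt; apply/negP=> jk.
have k_gt0 : 0 < k by apply: leq_ltn_trans jk.
have kn : k.-1 < n by rewrite -ltnS prednK.
move: (kP (Ordinal kn)) (jP (Ordinal kn)).
rewrite /= prednK // leqnn eqxx -ltnS prednK // jk addbT => -> // /eqP.
by case: (y _).
Qed.

Lemma width_word_graph0 : width (word_graph ord0) = 2 ^ n.
Proof.
rewrite width_label_graph; last exact: word_label_nbr.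
(* At index 0 nothing is zeroed or flipped, so the label of a vertex is its word. *)
have -> : word_label ord0 @: [set: bool * W] = [set: W].
  apply/setP=> x; rewrite in_setT; apply/imsetP; exists (false, x) => //.
  by apply/ffunP=> i; rewrite ffunE addbF.
by rewrite cardsT card_ffun card_bool card_ord.
Qed.

(** The constant label makes all pairs on opposite sides adjacent. *)
Definition word_biclique : graph (bool * W)%type :=
  label_graph fst (fun _ => tt).

Lemma word_biclique_biclique : biclique word_biclique.
Proof.
exists [set v | ~~ v.1], [set v | v.1]; split.
- by apply/set0Pn; exists (false, [ffun=> false]); rewrite inE.
- by apply/set0Pn; exists (true, [ffun=> false]); rewrite inE.
- by apply/pred0P=> v /=; rewrite !inE andNb.
- by apply/setP=> v; rewrite !inE orNb.
by move=> u v; rewrite /= /label_adj !inE; case: u.1; case: v.1.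
Qed.

Lemma word_graph_partition : bi_equivalence_partition word_biclique word_graph.
Proof.
split=> [j|j|].
- exact/label_graph_bi_equivalence/word_label_nbr.
- by split=> // u v /andP[suv _]; apply/andP.
move=> [s x] [t y] /andP[/= nst _].
have -> : t = ~~ s by case: s t nst => [] [].
have [j [jP j_uniq]] := word_label_agree_uniq x y s.
exists j; split=> [|k /andP[_ /j_uniq] //].
by rewrite /= /label_adj jP andbT; case: s {jP j_uniq nst}.
Qed.

Lemma word_graph_spanning : spanning word_biclique word_graph.
Proof. by move=> j v _; apply: word_label_nbr. Qed.

End BinaryWords.

Theorem theorem3 (r : nat) (hr : 1 <= r) :
  (forall (T : finType) (G : graph T) (Gs : 'I_r -> graph T),
     biclique G -> bi_equivalence_partition G Gs -> spanning G Gs ->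
     forall i : 'I_r, width (Gs i) <= 2 ^ (r - 1)) /\
  (exists (T : finType) (G : graph T) (Gs : 'I_r -> graph T),
     [/\ biclique G, bi_equivalence_partition G Gs, spanning G Gs
       & exists i : 'I_r, width (Gs i) = 2 ^ (r - 1)]).
Proof.
case: r hr => // n _; rewrite subn1 /=; split=> [T G Gs bG pG _ i|].
  exact: width_bi_equivalence_partition bG pG.
exists (bool * {ffun 'I_n -> bool})%type, (word_biclique n), (@word_graph n).
split.
- exact: word_biclique_biclique.
- exact: word_graph_partition.
- exact: word_graph_spanning.
by exists ord0; apply: width_word_graph0.
Qed.
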